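(* In the setting described in the context, assume that $\mathsf U_i^n\in\mathcal A$ for all $i\in\mathcal V$, and that $\tau\le\min_{i\in\mathcal V}\frac{m_i}{2|d_{ii}^{L,n}|}$. Then, for every $i\in\mathcal V$, $$\mathsf H_{i,\min}^n\le\mathsf H(\mathsf U_i^{L,n+1})\quad\text{and}\quad\mathsf H(\mathsf U_i^{L,n+1})\le\mathsf H_{i,\max}^n,$$ $$\|\mathsf Q(\mathsf U_i^{L,n+1})\|_{\ell^2}^2\le\mathsf H(\mathsf U_i^{L,n+1})^2\,\mathsf V_{i,\max}^{2,n}\qquad\text{if }\epsilon h_{\max}\le\mathsf H_{i,\min}^n.$$
   Context: Setting: low-order approximation of the shallow water equations in dimension $d\in\{1,2\}$ with forward Euler time stepping. States and flux. $\mathcal A=\{(h,q)^T\in\mathbb R^{d+1}: h>0\}$. Linear maps $\mathsf H:\mathbb R^{d+1}\to\mathbb R$ and $\mathsf Q:\mathbb R^{d+1}\to\mathbb R^d$ extract depth and discharge of a state $(h,q)^T$. $g>0$ is the gravity constant. The flux is $\mathbb f(u)=(q,\ q\otimes v+\frac12 g h^2 I_d)^T$ with $v=q/h$, so for $c\in\mathbb R^d$: $\mathbb f(u)c=(q\cdot c,\ (v\cdot c)q+\frac12 gh^2c)^T$ (zero if $h=0$, $q=0$). Discretization. $\mathcal V=\{1,\dots,I\}$ indexes the degrees of freedom; for each $i\in\mathcal V$, $\mathcal I(i)\subsetneq\mathcal V$ is the stencil at $i$ (containing $i$), and $\mathcal I^*(i)=\mathcal I(i)\setminus\{i\}$. Given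 are masses $m_i>0$ and vectors $c_{ij}\in\mathbb R^d$ with $\sum_{j\in\mathcal I(i)}c_{ij}=0$, $c_{ij}=0$ if $j\notin\mathcal I(i)$, and $c_{ij}=-c_{ji}$ whenever $i$ or $j$ is not a boundary degree of freedom. The topography is given by real numbers $\mathsf Z_i$. The state at time $t^n$ is $\mathsf U_i^n=(\mathsf H_i^n,\mathsf Q_i^n)^T\in\mathbb R^{d+1}$, $i\in\mathcal V$; $\tau>0$ is the time step. Velocity. With a small parameter $\epsilon>0$ and a depth scale $h_{\max}>0$, the regularized velocity of a state $\mathsf U$ is $\mathsf V(\mathsf U)=\frac{2\mathsf H(\mathsf U)}{\mathsf H(\mathsf U)^2+\max(\mathsf H(\mathsf U),\epsilon h_{\max})^2}\mathsf Q(\mathsf U)$ (equal to $\mathsf Q/\mathsf H$ when $\mathsf H\ge\epsilon h_{\max}$), and $\mathsf V_i^n=\mathsf V(\mathsf U_i^n)$. Hydrostatic reconstruction. $\mathsf H_i^{*,j}=\max(0,\mathsf H_i^n+\mathsf Z_i-\max(\mathsf Z_i,\mathsf Z_j))$, $\mathsf U_i^{*,j}=(\mathsf H_i^{*,j},\mathsf H_i^{*,j}\mathsf V_i^n)^T$. Graph viscosity. For $j\in\mathcal I^*(i)$, $d_{ij}^{L,n}=\max\big(\lambda_{\max}(\mathsf U_i^{*,j},\mathsf U_j^{*,i},n_{ij})\|c_{ij}\|_{\ell^2},\ \lambda_{\max}(\mathsf U_j^{*,i},\mathsf U_i^{*,j},n_{ji})\|c_{ji}\|_{\ell^2}\big)$,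 where $n_{ij}=c_{ij}/\|c_{ij}\|_{\ell^2}$ and $\lambda_{\max}(\mathsf U_\ell,\mathsf U_r,n)$ is a guaranteed upper bound on the maximum wave speed in the one-dimensional Riemann problem with left state $\mathsf U_\ell$, right state $\mathsf U_r$ and flux $\mathbb f(\cdot)n$. Also $d_{ii}^{L,n}=-\sum_{j\in\mathcal I^*(i)}d_{ij}^{L,n}$. Low-order update. $\frac{m_i}{\tau}(\mathsf U_i^{L,n+1}-\mathsf U_i^n)=\sum_{j\in\mathcal I(i)}\mathsf F_{ij}^{L,n}$ with $$\mathsf F_{ij}^{L,n}=-\big(\mathsf U_j^{*,i}\otimes\mathsf V_j^n+\mathsf U_i^{*,j}\otimes\mathsf V_i^n\big)c_{ij}+d_{ij}^{L,n}(\mathsf U_j^{*,i}-\mathsf U_i^{*,j})-\begin{pmatrix}0\\ g\,c_{ij}\big(\tfrac12(\mathsf H_j^{*,i})^2-\tfrac12(\mathsf H_i^{*,j})^2+(\mathsf H_i^n)^2\big)\end{pmatrix}.$$ Auxiliary states. For $j\in\mathcal I^*(i)$, $\overline{\mathsf U}_{ij}^n=\frac12(\mathsf U_i^{*,j}+\mathsf U_j^{*,i})-\frac{1}{2d_{ij}^{L,n}}\big(\mathbb f(\mathsf U_j^{*,i})-\mathbb f(\mathsf U_i^{*,j})\big)c_{ij}$, with the convention $\overline{\mathsf U}_{ii}^n=\mathsf U_i^n$. Affine shift. $\mathsf B_i^{L,n}=\sum_{j\in\mathcal I(i)}\mathsf B_{ij}^{L,n}$ with $\mathsf B_{ij}^{L,n}=-2(d_{ij}^{L,n}+\mathsf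 V_i^n\cdot c_{ij})(\mathsf U_i^{*,j}-\mathsf U_i^n)$. Local bounds. For $j\in\mathcal I(i)$, $\overline{\mathsf W}_{ij}^n=\overline{\mathsf U}_{ij}^n+\frac{\tau}{m_i}\mathsf B_i^{L,n}$; $\mathsf H_{i,\min}^n=\min_{j\in\mathcal I(i)}\mathsf H(\overline{\mathsf W}_{ij}^n)$, $\mathsf H_{i,\max}^n=\max_{j\in\mathcal I(i)}\mathsf H(\overline{\mathsf W}_{ij}^n)$, $\mathsf V_{i,\max}^{2,n}=\max_{j\in\mathcal I(i)}\|\mathsf V(\overline{\mathsf W}_{ij}^n)\|_{\ell^2}^2$.
   Formalization: The diagonal reconstructed state U_i^{*,i} is taken to be U_i^n instead of (H_i^n, H_i^n V_i^n); the two differ only if H_i^n < ε h_max and Q_i^n ≠ 0, where with the literal formula the velocity bound can fail. *)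

(* Defs.v *)
From HB Require Import structures.
From mathcomp Require Import all_boot all_order all_algebra.
From mathcomp Require Import all_classical all_reals all_analysis.

Set Implicit Arguments.
Unset Strict Implicit.
Unset Printing Implicit Defensive.

Import Order.TTheory GRing.Theory Num.Theory.
Import numFieldNormedType.Exports.

Local Open Scope classical_set_scope.
Local Open Scope ring_scope.

Section StatesAndFlux.
Variables (R : realType) (d : nat).

Definition dot (v w : 'cV[R]_d) : R := \sum_k v k 0 * w k 0.

(* The norm `|v| of mathcomp-analysis on matrices is the sup norm, hence this
   definition. *)
Definition norm2 (v : 'cV[R]_d) : R := Num.sqrt (dot v v).

Definition state := 'cV[R]_(1 + d).

Definition mkstate (h : R) (q : 'cV[R]_d) : state := col_mx h%:M q.
Definition depth (u : state) : R := usubmx u 0 0.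
Definition discharge (u : state) : 'cV[R]_d := dsubmx u.

Definition admissible (u : state) : Prop := 0 < depth u.
Definition admissible_or_dry (u : state) : Prop := admissible u \/ u = 0.

(* Since 0^-1 = 0, this is 0 at the dry state, and so is the flux. *)
Definition velocity (u : state) : 'cV[R]_d := (depth u)^-1 *: discharge u.

Definition flux (g : R) (u : state) : 'M[R]_(1 + d, d) :=
  col_mx (discharge u)^T
    (discharge u *m (velocity u)^T + (2^-1 * g * depth u ^+ 2)%:M).

(* u (x) V, as a (1 + d) x d matrix. *)
Definition tensor (u : state) (v : 'cV[R]_d) : 'M[R]_(1 + d, d) := u *m v^T.

(* Energy entropy pair of the shallow water equations (flat bottom). *)
Definition entropy (g : R) (u : state) : R :=
  2^-1 * depth u * norm2 (velocity u) ^+ 2 + 2^-1 * g * depth u ^+ 2.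
Definition entropy_flux (g : R) (u : state) (n : 'cV[R]_d) : R :=
  (entropy g u + 2^-1 * g * depth u ^+ 2) * dot (velocity u) n.

(* The regularized velocity; [depth_cutoff] is epsilon * h_max. *)
Definition regularized_velocity (depth_cutoff : R) (u : state) : 'cV[R]_d :=
  (2 * depth u / (depth u ^+ 2 + Num.max (depth u) depth_cutoff ^+ 2))
    *: discharge u.

Definition integrable_on (a b : R) (f : R -> R) : Prop :=
  (@lebesgue_measure R).-integrable `[a, b] (EFin \o f).

Definition interval_integral (a b : R) (f : R -> R) : R :=
  Rintegral (@lebesgue_measure R) `[a, b] f.

Definition vintegral (a b : R) (f : R -> state) : state :=
  \col_k interval_integral a b (fun s => f s k 0).

(* Entropy solution u(x, t), t >= 0, of the Riemann problem
     d_t u + d_x (flux(u) n) = 0,   u(x, 0) = ul (x < 0),  ur (x >= 0),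
   in integral form on all space-time rectangles [x1, x2] x [t1, t2]. *)
Definition riemann_solution (g : R) (ul ur : state) (n : 'cV[R]_d)
    (u : R -> R -> state) : Prop :=
  [/\ forall x, u x 0 = if x < 0 then ul else ur,
      forall x t, 0 <= t -> admissible_or_dry (u x t),
      forall x1 x2 t, x1 < x2 -> 0 <= t ->
        (forall k, integrable_on x1 x2 (fun x => u x t k 0))
        /\ integrable_on x1 x2 (fun x => entropy g (u x t)),
      forall x t1 t2, 0 <= t1 -> t1 < t2 ->
        (forall k, integrable_on t1 t2 (fun t => (flux g (u x t) *m n) k 0))
        /\ integrable_on t1 t2 (fun t => entropy_flux g (u x t) n)
    & forall x1 x2 t1 t2, x1 < x2 -> 0 <= t1 -> t1 < t2 ->
        vintegral x1 x2 (u^~ t2) - vintegral x1 x2 (u^~ t1)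
          + (vintegral t1 t2 (fun t => flux g (u x2 t) *m n)
             - vintegral t1 t2 (fun t => flux g (u x1 t) *m n)) = 0
        /\ interval_integral x1 x2 (fun x => entropy g (u x t2))
           - interval_integral x1 x2 (fun x => entropy g (u x t1))
           + (interval_integral t1 t2 (fun t => entropy_flux g (u x2 t) n)
              - interval_integral t1 t2 (fun t => entropy_flux g (u x1 t) n)) <= 0].

(* s is an upper bound on the maximum wave speed of the Riemann problem: all
   the waves of its solution stay in the cone |x| <= s t. The existence of the
   solution is part of the property, otherwise it could hold vacuously. *)
Definition wave_speed_bound (g : R) (ul ur : state) (n : 'cV[R]_d) (s : R) :
    Prop :=
  0 <= s /\
  exists2 u, riemann_solution g ul ur n u &
    forall x t, 0 < t ->
      (x < - (s * t) -> u x t = ul) /\ (s * t < x -> u x t = ur).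

End StatesAndFlux.

Record scheme (R : realType) (d : nat) := Scheme {
  gravity : R;
  gravity_gt0 : 0 < gravity;
  eps : R;
  eps_gt0 : 0 < eps;
  hmax : R;
  hmax_gt0 : 0 < hmax;
  (* number of degrees of freedom *)
  ndof : nat;
  boundary : {set 'I_ndof};
  stencil : forall i : 'I_ndof, {set 'I_ndof};
  stencil_proper : forall i, stencil i \proper [set: 'I_ndof];
  stencil_self : forall i, i \in stencil i;
  mass : forall i : 'I_ndof, R;
  mass_gt0 : forall i, 0 < mass i;
  cij : forall i j : 'I_ndof, 'cV[R]_d;
  cij_sum : forall i, \sum_(j in stencil i) cij i j = 0;
  cij_out : forall i j, j \notin stencil i -> cij i j = 0;
  cij_skew : forall i j, (i \notin boundary) || (j \notin boundary) ->
    cij i j = - cij j i;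
  topography : forall i : 'I_ndof, R;
  lambda_max : forall (ul ur : state R d) (n : 'cV[R]_d), R;
  lambda_maxP : forall ul ur n,
    admissible_or_dry ul -> admissible_or_dry ur -> norm2 n = 1 ->
    wave_speed_bound gravity ul ur n (lambda_max ul ur n)
}.

Arguments stencil {R d} s i.
Arguments mass {R d} s i.
Arguments cij {R d} s i j.
Arguments topography {R d} s i.
Arguments lambda_max {R d} s ul ur n.

Section LowOrderScheme.
Variables (R : realType) (d : nat) (S : scheme R d).
Variables (tau : R) (U : 'I_(ndof S) -> state R d).

Local Notation g := (gravity S).
Local Notation Z := (topography S).
Local Notation I := (stencil S).
Local Notation c := (cij S).
Local Notation m := (mass S).

Definition depth_cutoff : R := eps S * hmax S.

Definition reg_velocity (u : state R d) : 'cV[R]_d :=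
  regularized_velocity depth_cutoff u.

Definition vel (i : 'I_(ndof S)) : 'cV[R]_d := reg_velocity (U i).

Definition Hstar (i j : 'I_(ndof S)) : R :=
  Num.max 0 (depth (U i) + Z i - Num.max (Z i) (Z j)).

(* No reconstruction takes place between a degree of freedom and itself, so
   that U_i^{*,i} = U_i. This agrees with the general formula when the depth of
   U_i is at least epsilon * h_max; below that value the formula would replace
   the discharge Q_i by H_i V_i, and the velocity bound would fail. *)
Definition Ustar (i j : 'I_(ndof S)) : state R d :=
  if j == i then U i else mkstate (Hstar i j) (Hstar i j *: vel i).

Definition unit_normal (i j : 'I_(ndof S)) : 'cV[R]_d :=
  (norm2 (c i j))^-1 *: c i j.

Definition viscosity_offdiag (i j : 'I_(ndof S)) : R :=
  Num.max
    (lambda_max S (Ustar i j) (Ustar j i) (unit_normal i j) * norm2 (c i j))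
    (lambda_max S (Ustar j i) (Ustar i j) (unit_normal j i) * norm2 (c j i)).

Definition viscosity (i j : 'I_(ndof S)) : R :=
  if j == i then - \sum_(k in I i :\ i) viscosity_offdiag i k
  else viscosity_offdiag i j.

Definition low_order_flux (i j : 'I_(ndof S)) : state R d :=
  - ((tensor (Ustar j i) (vel j) + tensor (Ustar i j) (vel i)) *m c i j)
  + viscosity i j *: (Ustar j i - Ustar i j)
  - mkstate 0 ((g * (2^-1 * Hstar j i ^+ 2 - 2^-1 * Hstar i j ^+ 2
                     + depth (U i) ^+ 2)) *: c i j).

Definition low_order_update (Unew : 'I_(ndof S) -> state R d) : Prop :=
  forall i,
    (m i / tau) *: (Unew i - U i) = \sum_(j in I i) low_order_flux i j.

(* If viscosity i j = 0 the second term is 0, because x / 0 = 0. *)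
Definition Ubar (i j : 'I_(ndof S)) : state R d :=
  if j == i then U i
  else 2^-1 *: (Ustar i j + Ustar j i)
       - (1 / (2 * viscosity i j))
           *: ((flux g (Ustar j i) - flux g (Ustar i j)) *m c i j).

Definition Bij (i j : 'I_(ndof S)) : state R d :=
  - (2 * (viscosity i j + dot (vel i) (c i j))) *: (Ustar i j - U i).

Definition affine_shift (i : 'I_(ndof S)) : state R d := \sum_(j in I i) Bij i j.

Definition Wbar (i j : 'I_(ndof S)) : state R d :=
  Ubar i j + (tau / m i) *: affine_shift i.

(* The stencil of i contains i, so the value at j = i serves as the initial
   value of the iterated minimum and maxima. *)
Definition Hmin (i : 'I_(ndof S)) : R :=
  \big[Num.min/depth (Wbar i i)]_(j in I i) depth (Wbar i j).

Definition Hmax (i : 'I_(ndof S)) : R :=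
  \big[Num.max/depth (Wbar i i)]_(j in I i) depth (Wbar i j).

Definition V2max (i : 'I_(ndof S)) : R :=
  \big[Num.max/norm2 (reg_velocity (Wbar i i)) ^+ 2]_(j in I i)
    norm2 (reg_velocity (Wbar i j)) ^+ 2.

(* tau <= min_i m_i / (2 |d_ii|), where d_ii = 0 imposes no restriction. *)
Definition cfl : Prop :=
  forall i, viscosity i i != 0 -> tau <= m i / (2 * `|viscosity i i|).

End LowOrderScheme.

(* Main.v *)
Require Import Defs.
From mathcomp Require Import all_boot all_order all_algebra.
From mathcomp Require Import all_classical all_reals all_analysis.
From mathcomp Require Import ring lra.
Import Order.TTheory GRing.Theory Num.Theory.
Local Open Scope ring_scope.

(** The update is a convex combination of the states [Wbar i j], [j] in the
    stencil of [i]. A reconstructed state of depth [h] has discharge [h V_i] or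
    [h V_j], so the tensor terms of the scheme are the shallow water fluxes of
    these states up to pressure terms, and the numerical flux can be rearranged
    into
    [2 d_ij Ubar_ij + B_ij - 2 (d_ij + V_i . c_ij) U_i - g H_i^2 (0, c_ij)]
    ([low_order_fluxE]). Summing over the stencil removes the last two terms,
    because both [d_ij] and [c_ij] sum to zero, and what is left says that
    [U_i^{n+1}] is the average of the [Wbar i j] with the weights
    [delta_ij + 2 tau d_ij / m_i] ([low_order_update_convex]). These add up to
    one, they are nonnegative off the diagonal because wave speeds are, and the
    time step restriction is exactly nonnegativity of the diagonal one.

    The rearrangement divides by [d_ij]. If [d_ij = 0] while [c_ij <> 0], the
    bound on the wave speeds of the Riemann problem vanishes, so its solution does
    not change in time and the conservation law forces the two fluxes to agree in
    the direction [c_ij] ([wave_speed_bound0_flux]); nothing is lost by reading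
    the quotient as zero.

    The bounds then follow from convexity. The depth is linear. For the
    velocity, all [Wbar i j] are above the regularization cut-off, where the
    regularized velocity is the true one, and [|q| <= M h] defines a convex cone
    ([convex_velocity_bound]). *)

(** * Bounds stable under convex combinations *)

Section ConvexBounds.
Context {R : realType} {J : finType} (A : {set J}) (w x : J -> R).

Lemma convex_ge_bigmin x0 :
  (forall j, j \in A -> 0 <= w j) -> \sum_(j in A) w j = 1 ->
  \big[Num.min/x0]_(j in A) x j <= \sum_(j in A) w j * x j.
Proof.
move=> w_ge0 w_sum; rewrite -[leLHS]mul1r -w_sum mulr_suml.
apply: ler_sum => j jA.
by rewrite ler_wpM2l ?w_ge0 //; apply: bigmin_le_cond.
Qed.

Lemma convex_le_bigmax x0 :
  (forall j, j \in A -> 0 <= w j) -> \sum_(j in A) w j = 1 ->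
  \sum_(j in A) w j * x j <= \big[Num.max/x0]_(j in A) x j.
Proof.
move=> w_ge0 w_sum; rewrite -[leRHS]mul1r -w_sum mulr_suml.
apply: ler_sum => j jA.
by rewrite ler_wpM2l ?w_ge0 //; apply: le_bigmax_cond.
Qed.

End ConvexBounds.

(** * Euclidean product *)

Section Dot.
Context {R : realType} {d : nat}.
Implicit Types (v w : 'cV[R]_d).

Lemma dotC v w : dot v w = dot w v.
Proof. by apply: eq_bigr => k _; rewrite mulrC. Qed.

Lemma dotZl (a : R) v w : dot (a *: v) w = a * dot v w.
Proof. by rewrite /dot mulr_sumr; apply: eq_bigr => k _; rewrite !mxE mulrA. Qed.

Lemma dot0l v : dot 0 v = 0.
Proof. by rewrite -[0](scale0r 0) dotZl mul0r. Qed.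

Lemma dot_suml (J : finType) (A : {set J}) (v : J -> 'cV[R]_d) w :
  dot (\sum_(j in A) v j) w = \sum_(j in A) dot (v j) w.
Proof.
rewrite /dot exchange_big /=; apply: eq_bigr => k _.
by rewrite summxE mulr_suml.
Qed.

Lemma dot_ge0 v : 0 <= dot v v.
Proof. by apply: sumr_ge0 => k _; rewrite -expr2 sqr_ge0. Qed.

Lemma sqr_norm2 v : norm2 v ^+ 2 = dot v v.
Proof. by rewrite sqr_sqrtr // dot_ge0. Qed.

Lemma norm2_eq0 v : norm2 v = 0 -> v = 0.
Proof.
move=> v0; have : dot v v == 0 by rewrite -sqr_norm2 v0 expr0n.
rewrite psumr_eq0 => [/allP dv|k _]; last by rewrite -expr2 sqr_ge0.
apply/matrixP => k l; rewrite (ord1 l) mxE; apply/eqP.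
by have := dv k (mem_index_enum _); rewrite -expr2 sqrf_eq0.
Qed.

Lemma norm2_0 : norm2 (0 : 'cV[R]_d) = 0.
Proof. by rewrite /norm2 dot0l sqrtr0. Qed.

Lemma norm2_normalize v : v != 0 -> norm2 ((norm2 v)^-1 *: v) = 1.
Proof.
move=> v_neq0; have nv : norm2 v != 0.
  by apply: contra v_neq0 => /eqP/norm2_eq0 ->.
rewrite {1}/norm2 dotZl dotC dotZl -sqr_norm2.
by rewrite expr2 mulKf // mulVf // sqrtr1.
Qed.

Lemma dot_le_half_sum v w : 2 * dot v w <= dot v v + dot w w.
Proof.
rewrite /dot mulr_sumr -big_split /=; apply: ler_sum => k _.
by rewrite -subr_ge0; have := sqr_ge0 (v k 0 - w k 0); nra.
Qed.

(** On [h >= 0] the condition [|q|^2 <= B h^2] describes a convex cone. Expanding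
    the square into a double sum, every cross term [v_j . v_k] is at most [B] by
    [dot_le_half_sum]. *)
Lemma convex_velocity_bound (J : finType) (A : {set J}) (w h : J -> R)
    (v : J -> 'cV[R]_d) (B : R) (q := \sum_(j in A) w j *: (h j *: v j)) :
  (forall j, j \in A -> 0 <= w j * h j) ->
  (forall j, j \in A -> dot (v j) (v j) <= B) ->
  dot q q <= (\sum_(j in A) w j * h j) ^+ 2 * B.
Proof.
move=> wh_ge0 v_le; rewrite {}/q dot_suml expr2 !mulr_suml.
apply: ler_sum => j jA; rewrite dotC dot_suml mulr_sumr mulr_suml.
apply: ler_sum => k kA; rewrite !scalerA !dotZl dotC dotZl.
rewrite [X in X <= _](_ : _ = w j * h j * (w k * h k) * dot (v j) (v k)).
  apply: ler_wpM2l; first by apply: mulr_ge0; exact: wh_ge0.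
  have := dot_le_half_sum (v j) (v k); have := v_le _ jA; have := v_le _ kA.
  lra.
ring.
Qed.

End Dot.

(** * States and the flux *)

Section States.
Context {R : realType} {d : nat}.
Implicit Types (u : state R d) (c v q : 'cV[R]_d).

Lemma depth_sum (J : finType) (A : {set J}) (w : J -> R) (u : J -> state R d) :
  depth (\sum_(j in A) w j *: u j) = \sum_(j in A) w j * depth (u j).
Proof.
by rewrite /depth linear_sum summxE; apply: eq_bigr => j _; rewrite linearZ mxE.
Qed.

Lemma discharge_sum (J : finType) (A : {set J}) (w : J -> R)
    (u : J -> state R d) :
  discharge (\sum_(j in A) w j *: u j) = \sum_(j in A) w j *: discharge (u j).
Proof.
by rewrite /discharge linear_sum; apply: eq_bigr => j _; rewrite linearZ.
Qed.

Lemma mkstate00 : mkstate 0 0 = 0 :> state R d.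
Proof.
rewrite -[RHS]col_mx0; congr col_mx.
by apply/matrixP => k l; rewrite !mxE mul0rn.
Qed.

Lemma mkstate0Z (a : R) c : mkstate 0 (a *: c) = a *: mkstate 0 c.
Proof. by rewrite /mkstate scale_col_mx scale_scalar_mx mulr0. Qed.

Lemma mkstate0_sum (J : finType) (A : {set J}) (c : J -> 'cV[R]_d) :
  \sum_(j in A) mkstate 0 (c j) = mkstate 0 (\sum_(j in A) c j).
Proof.
by apply/esym/big_morph => [x y|]; rewrite ?mkstate00 // /mkstate add_col_mx;
  congr col_mx; apply/matrixP => k l; rewrite !mxE mul0rn addr0.
Qed.

Lemma mulmx_dot v c : v^T *m c = (dot v c)%:M.
Proof.
apply/matrixP => k l; rewrite !mxE !ord1 eqxx mulr1n.
by apply: eq_bigr => i _; rewrite mxE.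
Qed.

Lemma tensor_mul u v c : tensor u v *m c = dot v c *: u.
Proof. by rewrite /tensor -mulmxA mulmx_dot mul_mx_scalar. Qed.

(** At [h = 0] both sides vanish whatever [v] is, although the velocity of the
    state is then [0] rather than [v]. *)
Lemma flux_mkstate (g h : R) v c (u := mkstate h (h *: v)) :
  flux g u *m c = dot v c *: u + (2^-1 * g * h ^+ 2) *: mkstate 0 c.
Proof.
have uh : depth u = h by rewrite /depth /u /mkstate col_mxKu mxE eqxx mulr1n.
have uq : discharge u = h *: v by rewrite /discharge col_mxKd.
rewrite /flux /velocity uh uq mul_col_mx mulmxDl mul_scalar_mx /u {u uh uq}.
have [->|h_neq0] := eqVneq h 0.
  rewrite !scale0r mkstate00 !trmx0 !mul0mx expr0n /= !mulr0 !scale0r.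
  by rewrite !addr0 scaler0 col_mx0.
rewrite scalerA mulVf // scale1r -mulmxA !mulmx_dot mul_mx_scalar.
rewrite /mkstate !scale_col_mx add_col_mx; congr col_mx.
rewrite dotZl !scale_scalar_mx mulr0 mulrC.
by apply/matrixP => k l; rewrite !mxE mul0rn addr0.
Qed.

(** Above the cut-off the regularization is inactive. *)
Lemma discharge_regularized (cutoff : R) u : 0 < cutoff -> cutoff <= depth u ->
  discharge u = depth u *: regularized_velocity cutoff u.
Proof.
move=> cutoff_gt0 le_cutoff; rewrite /regularized_velocity (max_l le_cutoff).
have u_neq0 : depth u != 0 by rewrite gt_eqF // (lt_le_trans cutoff_gt0).
rewrite scalerA; set a := (X in X *: _); suff -> : a = 1 by rewrite scale1r.
rewrite /a; field.
by rewrite -mulr2n mulrn_eq0 expf_eq0.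
Qed.

End States.

(** * Riemann problems without moving waves *)

Lemma eq_interval_integral_off_point (R : realType) (a b r : R) (f h : R -> R) :
  integrable_on a b f -> integrable_on a b h ->
  (forall x, x != r -> f x = h x) ->
  interval_integral a b f = interval_integral a b h.
Proof.
move=> fi hi fh; rewrite /interval_integral /Rintegral.
have offpoint k : integrable_on a b k ->
    (\int[@lebesgue_measure R]_(x in `[a, b] `\ r) (k x)%:E =
     \int[@lebesgue_measure R]_(x in `[a, b]) (k x)%:E)%E.
  case/integrableP => mk _; apply: integral_setD1; first exact: measurableD.
  by apply: measurable_funS mk => //; exact: subDsetl.
rewrite -(offpoint f) // -(offpoint h) //; congr fine.
apply: eq_integral => x; rewrite inE => -[_ /= /eqP xr].
by rewrite fh.
Qed.

Lemma interval_integral_cst (R : realType) (a b r : R) : a < b ->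
  interval_integral a b (fun=> r) = r * (b - a).
Proof.
move=> ab; rewrite /interval_integral Rintegral_cst //.
congr (_ * _); rewrite -[RHS]/(fine (b - a)%:E); congr fine.
by apply: etrans (lebesgue_measure_itv `[a, b]) _; rewrite /= lte_fin ab.
Qed.

(** If no wave leaves [x = 0] the solution is stationary off that line, and the
    conservation law on a rectangle crossing it reduces to the
    Rankine-Hugoniot condition with speed zero. *)
Lemma wave_speed_bound0_flux (R : realType) (d : nat) (g : R)
    (ul ur : state R d) (n : 'cV[R]_d) :
  wave_speed_bound g ul ur n 0 -> flux g ul *m n = flux g ur *m n.
Proof.
case=> _ [u [_ _ uint _ ucons] ucone]; apply/matrixP => k l; rewrite (ord1 l).
have ultE x t : 0 < t -> x < 0 -> u x t = ul.
  by move=> t0 x0; apply: (ucone x t t0).1; rewrite mul0r oppr0.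
have urtE x t : 0 < t -> 0 < x -> u x t = ur.
  by move=> t0 x0; apply: (ucone x t t0).2; rewrite mul0r.
(* The wave cone says nothing at time 0, hence the times 1 and 2. *)
have [cons _] : _ /\ _ := ucons (-1) 1 1 2 ltac:(lra) ltac:(lra) ltac:(lra).
move: cons => /matrixP/(_ k 0) cons; rewrite !mxE in cons; move: cons.
have -> : interval_integral (-1) 1 (fun s => u s 2 k 0)
        = interval_integral (-1) 1 (fun s => u s 1 k 0).
  have [int1 _] := uint (-1) 1 1 ltac:(lra) ltac:(lra).
  have [int2 _] := uint (-1) 1 2 ltac:(lra) ltac:(lra).
  apply: (eq_interval_integral_off_point _ _ _ 0 _ _ (int2 k) (int1 k)) => x.
  by rewrite neq_lt => /orP[] x0; [rewrite !(ultE x)|rewrite !(urtE x)].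
have fluxE x v : (forall t, 0 < t -> u x t = v) ->
    interval_integral 1 2 (fun t => (flux g (u x t) *m n) k 0)
    = (flux g v *m n) k 0.
  move=> uv; transitivity (interval_integral 1 2 (fun=> (flux g v *m n) k 0)).
    apply: eq_Rintegral => t; rewrite inE /= in_itv /= => /andP[t1 _].
    by rewrite uv // (lt_le_trans _ t1).
  by rewrite interval_integral_cst; [ring|lra].
rewrite (fluxE 1 ur) ?(fluxE (-1) ul); first lra.
- by move=> t t0; rewrite ultE //; lra.
- by move=> t t0; rewrite urtE.
Qed.

(** * The update as a convex combination *)

Section LowOrderScheme.
Context {R : realType} {d : nat} (S : scheme R d).
Context (U : 'I_(ndof S) -> state R d).

Local Notation I := (stencil S).
Local Notation c := (cij S).

Lemma UstarE i j : j != i ->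
  Ustar U i j = mkstate (Hstar U i j) (Hstar U i j *: vel U i).
Proof. by rewrite /Ustar => /negbTE ->. Qed.

Lemma Ustar_admissible_or_dry i j : j != i -> admissible_or_dry (Ustar U i j).
Proof.
move=> ji; rewrite UstarE //.
have : 0 <= Hstar U i j by rewrite /Hstar le_max lexx.
rewrite le_eqVlt => /predU1P[<-|h_gt0].
  by right; rewrite scale0r mkstate00.
by left; rewrite /admissible /depth col_mxKu mxE eqxx mulr1n.
Qed.

Lemma lambda_max_bound i j : j != i -> c i j != 0 ->
  wave_speed_bound (gravity S) (Ustar U i j) (Ustar U j i) (unit_normal i j)
    (lambda_max S (Ustar U i j) (Ustar U j i) (unit_normal i j)).
Proof.
move=> ji c_neq0; apply: lambda_maxP.
- exact: Ustar_admissible_or_dry.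
- by apply: Ustar_admissible_or_dry; rewrite eq_sym.
- exact: norm2_normalize.
Qed.

Lemma speed_norm_ge0 i j : j != i ->
  0 <= lambda_max S (Ustar U i j) (Ustar U j i) (unit_normal i j)
       * norm2 (c i j).
Proof.
move=> ji; have [c0|c_neq0] := eqVneq (c i j) 0.
  by rewrite c0 norm2_0 mulr0.
by rewrite mulr_ge0 ?sqrtr_ge0 //; case: (lambda_max_bound i j ji c_neq0).
Qed.

Lemma viscosityE i j : j != i -> viscosity U i j = viscosity_offdiag U i j.
Proof. by rewrite /viscosity => /negbTE ->. Qed.

Lemma viscosity_ge0 i j : j != i -> 0 <= viscosity U i j.
Proof. by move=> ji; rewrite viscosityE // le_max speed_norm_ge0. Qed.

Lemma viscosity_sum i : \sum_(j in I i) viscosity U i j = 0.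
Proof.
rewrite (big_setD1 i) ?stencil_self //= {1}/viscosity eqxx addrC.
apply/subr0_eq; rewrite subr0 -sumrB big1 // => j; rewrite !inE => /andP[ji _].
by rewrite viscosityE // subrr.
Qed.

(** Unless [c_ij = 0], a vanishing viscosity forces a vanishing wave speed bound,
    hence no flux jump; this makes the division by the viscosity in [Ubar]
    harmless. *)
Lemma viscosity0_flux i j : j != i -> viscosity U i j = 0 ->
  flux (gravity S) (Ustar U i j) *m c i j
  = flux (gravity S) (Ustar U j i) *m c i j.
Proof.
move=> ji; have [-> _|c_neq0] := eqVneq (c i j) 0; first by rewrite !mulmx0.
rewrite viscosityE // => visc0.
have nc_gt0 : 0 < norm2 (c i j).
  rewrite lt_def sqrtr_ge0 andbT; apply: contra c_neq0 => /eqP/norm2_eq0 ->.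
  exact: eqxx.
have bound := lambda_max_bound i j ji c_neq0.
have speed0 : lambda_max S (Ustar U i j) (Ustar U j i) (unit_normal i j) = 0.
  apply/le_anti; rewrite (proj1 bound) andbT.
  by rewrite -(pmulr_lle0 _ nc_gt0) -visc0 /viscosity_offdiag le_max lexx.
move: bound; rewrite speed0 => /wave_speed_bound0_flux.
rewrite /unit_normal -!scalemxAr => /(congr1 (fun x => norm2 (c i j) *: x)).
by rewrite !scalerA mulfV ?scale1r // gt_eqF.
Qed.

Lemma viscosity_Ubar i j : j != i ->
  (2 * viscosity U i j) *: Ubar U i j
  = viscosity U i j *: (Ustar U i j + Ustar U j i)
    - (flux (gravity S) (Ustar U j i) - flux (gravity S) (Ustar U i j))
        *m c i j.
Proof.
move=> ji; rewrite /Ubar (negbTE ji).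
have [visc0|visc_neq0] := eqVneq (viscosity U i j) 0.
  by rewrite visc0 mulr0 !scale0r mulmxBl viscosity0_flux // subrr subr0.
rewrite scalerBr !scalerA mul1r mulfV ?mulf_neq0 ?pnatr_eq0 // scale1r.
by congr (_ *: _ - _); rewrite mulrAC mulfV ?mul1r // pnatr_eq0.
Qed.

(** The shape is chosen for summation over [j]: the last two terms depend on
    [j] only through [d_ij + V_i . c_ij] and [c_ij], which sum to zero over the
    stencil. *)
Lemma low_order_fluxE i j :
  low_order_flux U i j
  = (2 * viscosity U i j) *: Ubar U i j + Defs.Bij U i j
    - (2 * (viscosity U i j + dot (vel U i) (c i j))) *: U i
    - (gravity S * depth (U i) ^+ 2) *: mkstate 0 (c i j).
Proof.
rewrite /low_order_flux /Defs.Bij mkstate0Z mulmxDl !tensor_mul.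
have [->|ji] := eqVneq j i.
  rewrite /Ubar /Ustar eqxx; apply/matrixP => k l; rewrite !mxE; ring.
have ij : i != j by rewrite eq_sym.
rewrite viscosity_Ubar // mulmxBl !UstarE // !flux_mkstate.
by apply/matrixP => k l; rewrite !mxE; ring.
Qed.

(** On the diagonal [d_ii] is minus the sum of the other viscosities, which is why
    the single formula gives weights that add up to one. *)
Definition weight (tau : R) (i j : 'I_(ndof S)) : R :=
  (j == i)%:R + 2 * (tau / mass S i) * viscosity U i j.

Lemma weight_sum tau i : \sum_(j in I i) weight tau i j = 1.
Proof.
rewrite big_split /= -mulr_sumr viscosity_sum mulr0 addr0.
rewrite (bigD1 i) ?stencil_self //= eqxx big1 ?addr0 // => j /andP[_].
by move=> /negbTE ->.
Qed.

(** Off the diagonal the viscosity is nonnegative; the diagonal weight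
    [1 - 2 tau |d_ii| / m_i] is where the time step restriction enters. *)
Lemma weight_ge0 tau i j : 0 < tau -> cfl tau U -> 0 <= weight tau i j.
Proof.
move=> tau_gt0 cflU; have m_gt0 := mass_gt0 i.
have tm_ge0 : 0 <= 2 * (tau / mass S i) by rewrite !mulr_ge0 ?invr_ge0 ?ltW.
rewrite /weight; have [->|ji] := eqVneq j i; last first.
  by rewrite add0r mulr_ge0 // viscosity_ge0.
have [->|visc_neq0] := eqVneq (viscosity U i i) 0.
  by rewrite mulr0 addr0.
have nvisc_gt0 : 0 < `|viscosity U i i| by rewrite normr_gt0.
have := cflU i visc_neq0; rewrite ler_pdivlMr ?mulr_gt0 // => cfl_i.
have : 2 * (tau / mass S i) * `|viscosity U i i| <= 1.
  rewrite mulrA mulrAC ler_pdivrMr // mul1r; apply: le_trans cfl_i.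
  by rewrite [2 * tau]mulrC -mulrA.
have : - `|viscosity U i i| <= viscosity U i i by rewrite lerNl -normrN ler_norm.
move=> /(ler_wpM2l tm_ge0); rewrite mulrN /=; lra.
Qed.

Lemma sum_low_order_flux i :
  \sum_(j in I i) low_order_flux U i j
  = \sum_(j in I i) (2 * viscosity U i j) *: Ubar U i j + affine_shift U i.
Proof.
under eq_bigr do rewrite low_order_fluxE -mkstate0Z.
rewrite !sumrB big_split /= mkstate0_sum -scaler_sumr cij_sum scaler0 mkstate00.
rewrite subr0 -scaler_suml -mulr_sumr big_split /= viscosity_sum add0r.
under [X in 2 * X]eq_bigr do rewrite dotC.
by rewrite -dot_suml cij_sum dot0l mulr0 scale0r subr0.
Qed.

Lemma low_order_update_convex tau (Unew : 'I_(ndof S) -> state R d) i :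
  0 < tau -> low_order_update tau U Unew ->
  Unew i = \sum_(j in I i) weight tau i j *: Wbar tau U i j.
Proof.
move=> tau_gt0 /(_ i); have m_gt0 := mass_gt0 i.
rewrite sum_low_order_flux => /(congr1 (fun x => (tau / mass S i) *: x)).
rewrite scalerA mulrA mulfVK ?gt_eqF // divff ?gt_eqF // scale1r.
move=> /(canRL (subrK _)) ->; rewrite scalerDr.
under [RHS]eq_bigr do rewrite /Wbar scalerDr.
rewrite big_split /= -scaler_suml weight_sum scale1r addrAC; congr (_ + _).
under [RHS]eq_bigr do rewrite /weight scalerDl.
rewrite big_split /= addrC; congr (_ + _).
  rewrite (bigD1 i) ?stencil_self //= eqxx scale1r big1 ?addr0.
    by rewrite /Ubar eqxx.
  by move=> j /andP[_ /negbTE ->]; rewrite scale0r.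
rewrite scaler_sumr; apply: eq_bigr => j _.
by rewrite scalerA mulrCA mulrA.
Qed.

End LowOrderScheme.

(** * The local bounds *)

Theorem lemma3p9 (R : realType) (d : nat) (S : scheme R d) (tau : R)
    (U Unew : 'I_(ndof S) -> state R d) :
  d = 1%N \/ d = 2%N ->
  0 < tau ->
  (forall i, admissible (U i)) ->
  cfl tau U ->
  low_order_update tau U Unew ->
  forall i,
    [/\ Hmin tau U i <= depth (Unew i),
        depth (Unew i) <= Hmax tau U i
      & eps S * hmax S <= Hmin tau U i ->
        norm2 (discharge (Unew i)) ^+ 2
          <= depth (Unew i) ^+ 2 * V2max tau U i].
Proof.
move=> _ tau_gt0 _ cflU upd i.
have w_ge0 j : 0 <= weight S U tau i j by apply: weight_ge0.
have w_sum := weight_sum S U tau i.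
rewrite (low_order_update_convex S U tau Unew i) // depth_sum; split.
- by apply: convex_ge_bigmin.
- by apply: convex_le_bigmax.
move=> cutoff_le; have cutoff_gt0 : 0 < eps S * hmax S.
  by rewrite mulr_gt0 ?eps_gt0 ?hmax_gt0.
have depth_ge j : j \in stencil S i -> eps S * hmax S <= depth (Wbar tau U i j).
  by move=> ji; apply: le_trans cutoff_le _; apply: bigmin_le_cond.
rewrite sqr_norm2 discharge_sum.
under eq_bigr => j ji.
  rewrite (discharge_regularized _ _ cutoff_gt0 (depth_ge j ji)).
  over.
apply: convex_velocity_bound => j ji.
  by rewrite mulr_ge0 // ltW // (lt_le_trans cutoff_gt0) ?depth_ge.
by rewrite -sqr_norm2; apply: le_bigmax_cond.
Qed.
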